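(* Let $\mathcal C\subset\mathcal D(\mathbb R_+)$ be a set of functions such that every $c\in\mathcal C$ satisfies $c'(x)>0$ for all $x\in\mathbb R_+$. Consider an atomic splittable congestion game with $n$ players $N=\{1,\dots,n\}$, finite resource set $E$ and cost functions $c_e\in\mathcal C$, $e\in E$, where each player's strategy space is of simplex type, $$K_i=\Big\{x_i\in\mathbb R_+^E:\ \sum_{e\in E}x_{i,e}=d_i\Big\},\qquad d_i>0,\quad i\in N.$$ Let $\eta>0$. Then every interior rest point $x^*\in\operatorname{relint}(K)$ of the Euclidean-regularized Frank--Wolfe dynamics $\dot x=\beta^\eta(F(x))-x$ on $K=\prod_{i\in N}K_i$ is locally exponentially stable.
   Context: $\mathbb R_+=[0,\infty)$. $\mathcal D(\mathbb R_+)$ is the set of $f\in C^2(\mathbb R_+)$ (real-valued) with $f'(x)\ge0$ and $2f'(x)+xf''(x)\ge0$ for all $x\in\mathbb R_+$. For $x\in K$ the load is $\bar x_e:=\sum_{i\in N}x_{i,e}$ and the marginal cost operator of the game is $F_{i,e}(x):=c_e(\bar x_e)+x_{i,e}c_e'(\bar x_e)$. For $\eta>0$, $\beta^\eta(z)=(\beta_i^\eta(z_i))_{i\in N}$ with $\beta_i^\eta(z_i):=\arg\min_{y_i\in K_i}\{\langle z_i,y_i\rangle+\frac{\eta}{2}\|y_i\|^2\}$. A rest point is $x^*\in K$ with $x^*=\beta^\eta(F(x^* ))$. $\operatorname{relint}(K)$ is the relative interior of $K$. Local exponential stability of $x^*$: there are a neighbourhood $W$ of $x^*$ relative to $K$ and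 constants $M,\alpha>0$ such that every solution with $x(0)\in W$ satisfies $\|x(t)-x^*\|\le Me^{-\alpha t}\|x(0)-x^*\|$ for all $t\ge0$. *)

(* Defs.v *)
From HB Require Import structures.
From mathcomp Require Import all_boot all_order all_algebra.
From mathcomp Require Import all_classical all_reals all_analysis.
Set Implicit Arguments.
Unset Strict Implicit.
Unset Printing Implicit Defensive.
Import Order.TTheory GRing.Theory Num.Theory.
Import numFieldNormedType.Exports.
Local Open Scope classical_set_scope.
Local Open Scope ring_scope.

(* Calculus on R_+ = [0, +oo[.  Functions on R_+ are represented by total
   functions R -> R whose values at negative reals are never consulted:
   difference quotients only use points of R_+, so that the derivative is the
   ordinary two-sided one at x > 0 and the right derivative at x = 0. *)
Section CalculusOnRplus.
Variable R : realType.
Implicit Types f : R -> R.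

Definition diff_quot_Rp f (x : R) : set_system R :=
  (fun y : R => (f y - f x) / (y - x)) @ within [set y : R | 0 <= y] x^'.

Definition derivable_Rp f (x : R) : Prop := cvg (diff_quot_Rp f x).

Definition deriv_Rp f (x : R) : R := lim (diff_quot_Rp f x).

Definition C2_Rp f : Prop :=
  [/\ forall x, 0 <= x -> derivable_Rp f x,
      forall x, 0 <= x -> derivable_Rp (deriv_Rp f) x &
      {within [set x : R | 0 <= x], continuous (deriv_Rp (deriv_Rp f))}].

Definition classD : set (R -> R) :=
  [set f | C2_Rp f /\
    forall x, 0 <= x ->
      0 <= deriv_Rp f x /\
      0 <= 2 * deriv_Rp f x + x * deriv_Rp (deriv_Rp f) x].

End CalculusOnRplus.

Section Geometry.
Variables (R : realType) (E : finType) (n : nat).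

Definition dot (z y : E -> R) : R := \sum_(e : E) z e * y e.

Definition enorm (y : E -> R) : R := Num.sqrt (dot y y).

(* The component x_{i,e} of x is x i e. *)
Definition pnorm (x : 'I_n -> E -> R) : R :=
  Num.sqrt (\sum_(i < n) dot (x i) (x i)).

Definition affine_hull (V : lmodType R) (A : set V) : set V :=
  [set y | exists (k : nat) (a : 'I_k -> R) (p : 'I_k -> V),
    [/\ \sum_(j < k) a j = 1, forall j, A (p j) &
        y = \sum_(j < k) a j *: p j]].

Definition relint (A : set ('I_n -> E -> R)) : set ('I_n -> E -> R) :=
  [set x | A x /\ exists r : R, 0 < r /\
    forall y, affine_hull A y -> pnorm (y - x) < r -> A y].

Definition argmin (T : Type) (A : set T) (g : T -> R) : set T :=
  [set y | A y /\ forall y', A y' -> g y <= g y'].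

End Geometry.

(* The atomic splittable congestion game with costs c and demands d. *)
Section Game.
Variables (R : realType) (E : finType) (n : nat).
Variables (c : E -> R -> R) (d : 'I_n -> R) (eta : R).

Definition strategies (i : 'I_n) : set (E -> R) :=
  [set y | (forall e, 0 <= y e) /\ \sum_(e : E) y e = d i].

Definition profiles : set ('I_n -> E -> R) :=
  [set x | forall i, strategies i (x i)].

Definition load (x : 'I_n -> E -> R) (e : E) : R := \sum_(i < n) x i e.

Definition marginal_cost (x : 'I_n -> E -> R) : 'I_n -> E -> R :=
  fun i e => c e (load x e) + x i e * deriv_Rp (c e) (load x e).

(* The argmin is a singleton for eta > 0 and E nonempty; the default value 0 of
   xget is only taken when it is empty. *)
Definition beta_i (i : 'I_n) (zi : E -> R) : E -> R :=
  xget 0 (argmin (strategies i)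
            (fun yi => dot zi yi + eta / 2 * enorm yi ^+ 2)).

Definition beta (z : 'I_n -> E -> R) : 'I_n -> E -> R :=
  fun i => beta_i i (z i).

Definition rest_point (xs : 'I_n -> E -> R) : Prop :=
  profiles xs /\ xs = beta (marginal_cost xs).

(* Solutions t |-> x t on R_+ of x' = beta (F x) - x with values in K; the time
   derivative at t = 0 is one-sided. *)
Definition fw_solution (x : R -> 'I_n -> E -> R) : Prop :=
  forall t, 0 <= t ->
    profiles (x t) /\
    forall i e,
      derivable_Rp (fun s => x s i e) t /\
      deriv_Rp (fun s => x s i e) t = beta (marginal_cost (x t)) i e - x t i e.

Definition rel_nbhs (xs : 'I_n -> E -> R) (W : set ('I_n -> E -> R)) : Prop :=
  W `<=` profiles /\
  exists r : R, 0 < r /\ forall y, profiles y -> pnorm (y - xs) < r -> W y.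

Definition locally_exp_stable (xs : 'I_n -> E -> R) : Prop :=
  exists (W : set ('I_n -> E -> R)) (M alpha : R),
    [/\ rel_nbhs xs W, 0 < M, 0 < alpha &
        forall x, fw_solution x -> W (x 0) ->
          forall t, 0 <= t ->
            pnorm (x t - xs) <= M * expR (- alpha * t) * pnorm (x 0 - xs)].

End Game.

(* Main.v *)
Require Import Defs.
From mathcomp Require Import all_boot all_order all_algebra.
From mathcomp Require Import all_classical all_reals all_analysis.
From mathcomp Require Import ring lra.
Import Order.TTheory GRing.Theory Num.Theory.
Import numFieldNormedType.Exports.
Local Open Scope classical_set_scope.
Local Open Scope ring_scope.

(** Write [h = x - xs] for the deviation from the rest point and
    [H_e = \sum_i h_{i,e}] for the deviation of the load.  The marginal cost
    operator need not be monotone, so [|h|^2] alone need not decrease; the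
    proof rests on the fact that the linearized dynamics is a cascade.

    At an interior rest point no sign constraint is active, hence for [x] close
    to [xs] the best response is affine in the marginal costs: player [i] moves
    by [- G_i / eta], projected on the vectors of zero sum, where
    [G = F x - F xs] ([beta_i_affine]).  The projection only adds a constant
    [mu_i] on each player's coordinates, and such constants are orthogonal both
    to [h_i] and to [H], which have zero sum ([lyapunov_dot_multiplier]).

    With difference quotients [q] of [c_e] and [p] of [c_e'] between the two
    loads one has exactly [G_{i,e} = a h_{i,e} + b_i H_e], where
    [a = c_e'(load) >= 0] and [b_i = q + xs_{i,e} p].  Summing over the players,
    [\sum_i G_{i,e} = (a + \sum_i b_i) H_e], which only involves [H]: the loads
    evolve autonomously and drive the individual deviations.  As
    [x -> xs], [a + \sum_i b_i] tends to [(n + 1) c' + X c''] at the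
    equilibrium load [X], which is nonnegative because [2 c' + X c'' >= 0]; it
    is therefore at least [- eta / 2] nearby ([resource_marginal_cost]).  So the
    loads contract, and the coupling term [b_i H_e h_{i,e}] is absorbed by
    giving the loads a large weight [kappa] in
    [|h|^2 + kappa \sum_e H_e^2] ([resource_dissipation]).  This function
    satisfies [V' <= - V / 2] near [xs], so that its small sublevel sets are
    invariant and it decays exponentially ([exp_decay]); being equivalent to
    [|h|^2], it gives the claimed estimate with rate [1 / 4]. *)

Set Implicit Arguments.
Unset Strict Implicit.
Unset Printing Implicit Defensive.

(** * Calculus on the half-line *)

(** Difference quotients are kept as exact slopes, with the value at [y = x]
    filled in by the derivative, so that the increments of the costs can be
    used as linear expressions without remainder terms. *)
Lemma slope_Rp (R : realType) (f : R -> R) (x eps : R) :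
  derivable_Rp f x -> 0 < eps ->
  exists2 r, 0 < r & forall y, 0 <= y -> `|y - x| < r ->
    exists2 q, `|q - deriv_Rp f x| < eps & f y - f x = q * (y - x).
Proof.
move=> dfx eps0.
have : \forall y \near within [set y : R | 0 <= y] x^',
    `|deriv_Rp f x - (f y - f x) / (y - x)| < eps.
  exact: cvgr_dist_lt dfx eps eps0.
rewrite near_withinE /dnbhs near_withinE => /nbhs_ballP[r /= r0 near_x].
exists r => // y y0 yx; have [->|y_neq] := eqVneq y x.
  by exists (deriv_Rp f x); rewrite !subrr ?normr0 ?mulr0.
exists ((f y - f x) / (y - x)); last by rewrite divfK// subr_eq0.
by rewrite distrC; apply: near_x => //; rewrite /ball/= distrC.
Qed.

Lemma is_derive_Rp (R : realType) (f : R -> R) (x : R) :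
  0 < x -> derivable_Rp f x -> is_derive x 1 f (deriv_Rp f x).
Proof.
move=> x0 dfx.
suff lim_f : (fun h => h^-1 *: ((f \o shift x) (h *: (1 : R)) - f x)) @ 0^'
    --> deriv_Rp f x.
  by split; [apply/cvg_ex; exists (deriv_Rp f x) | exact/cvg_lim].
apply/cvgrPdist_lt => eps eps0.
have [r r0 slope] := slope_Rp dfx eps0.
rewrite /dnbhs near_withinE; apply/nbhs_ballP.
exists (Num.min r x); first by rewrite /= lt_min r0.
move=> h /=; rewrite /ball/= sub0r normrN lt_min => /andP[hr hx] h0.
have [||q q_near] := slope (h + x).
- by move: hx; rewrite ltr_norml => /andP[? _]; lra.
- by rewrite addrK.
rewrite addrK [h *: _]mulr1 => ->.
by rewrite [_ *: _]mulrCA mulVf// mulr1 distrC.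
Qed.

Lemma continuous_Rp (R : realType) (f : R -> R) :
  (forall x, 0 <= x -> derivable_Rp f x) ->
  {within [set x : R | 0 <= x], continuous f}.
Proof.
move=> df; apply/subspace_continuousP => x x0; apply/cvgrPdist_lt => eps eps0.
have [r r0 slope] := slope_Rp (df x x0) ltr01.
rewrite near_withinE; apply/nbhs_ballP.
have D0 : 0 < `|deriv_Rp f x| + 1 by rewrite ltr_wpDl.
exists (Num.min r (eps / (`|deriv_Rp f x| + 1))).
  by rewrite /= lt_min r0 divr_gt0.
move=> y; rewrite /ball/= lt_min => /andP[yr y_eps] y0.
have [|q q_near eq_f] := slope y y0; first by rewrite distrC.
rewrite distrC eq_f normrM distrC; move: y_eps; rewrite ltr_pdivlMr//.
apply: le_lt_trans; rewrite mulrC distrC ler_wpM2l//.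
have := ler_normD (q - deriv_Rp f x) (deriv_Rp f x); rewrite subrK; lra.
Qed.

(** The differential inequality is only known where [V < r], but it keeps [V]
    there: [expR (k * t) * V t] decreases up to the first time at which
    [V >= r], so that at this time [V] would still be at most [V 0 < r]. *)
Lemma exp_decay (R : realType) (V V' : R -> R) (k r : R) : 0 <= k ->
  {within [set t : R | 0 <= t], continuous V} ->
  (forall t : R, 0 < t -> is_derive t 1 V (V' t)) ->
  (forall t, 0 < t -> V t < r -> V' t <= - k * V t) ->
  0 <= V 0 < r -> forall t, 0 <= t -> V t <= expR (- k * t) * V 0.
Proof.
move=> k0 cV dV V'_le /andP[V0ge0 V0r].
pose phi t := expR (k * t) * V t.
have cphi b : {within `[0, b], continuous phi}.
  have cV' : {within `[0, b], continuous V}.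
    apply: continuous_subspaceW cV => t /=.
    by rewrite in_itv/= => /andP[].
  move=> t; apply: cvgM; last exact: cV'.
  apply: continuous_subspaceT => {}t.
  apply: continuous_comp; last exact: continuous_expR.
  by apply: cvgM; [exact: cvg_cst | exact: cvg_id].
have dphi (t : R) : 0 < t ->
    is_derive t 1 phi (expR (k * t) * (V' t + k * V t)).
  move=> t0; have dVt := dV t t0.
  have dexp : is_derive t 1 (fun t : R => expR (k * t)) (expR (k * t) * k).
    apply: is_derive1_comp; have := @is_deriveZ _ _ _ id k t 1 1 _.
    by rewrite /GRing.scale/= mulr1; apply.
  apply: is_derive_eq (is_deriveM dexp dVt) _.
  by rewrite /GRing.scale/=; ring.
have decr b : 0 < b -> (forall t, 0 < t -> t < b -> V t < r) ->
    V b <= expR (- k * b) * V 0.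
  move=> b0 Vr; suff : phi b <= phi 0.
    rewrite /phi mulr0 expR0 mul1r mulrC -ler_pdivlMr ?expR_gt0//.
    by rewrite mulNr expRN mulrC.
  apply: (@ler0_derive1_le_cc _ phi 0 b); rewrite ?bound_itvE ?ltW//.
    by move=> t; rewrite in_itv/= => /andP[t0 _]; have [] := dphi t t0.
  move=> t; rewrite in_itv/= => /andP[t0 tb].
  rewrite derive1E (@derive_val _ _ _ _ _ _ _ (dphi t t0)).
  rewrite pmulr_rle0 ?expR_gt0//.
  have := V'_le t t0 (Vr t t0 tb); lra.
suff Vr t : 0 <= t -> V t < r.
  move=> t; rewrite le_eqVlt => /predU1P[<-|t0].
    by rewrite mulr0 expR0 mul1r.
  by apply: decr => // s s0 _; apply: Vr; exact: ltW.
move=> t0; rewrite ltNge; apply/negP => Vt.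
(* [T] is the first time at which [V] reaches the level [r]. *)
pose S := [set s : R | 0 <= s /\ r <= V s].
have lbS : has_lbound S by exists 0 => s [].
have infS : has_inf S by split; first by exists t.
pose T := inf S.
have T0 : 0 <= T by apply: lb_le_inf; [exists t | move=> s []].
have VT : r <= V T.
  rewrite leNgt; apply/negP => VTr.
  have /cvgrPdist_lt/(_ (r - V T)) :
      V s @[s --> within [set t : R | 0 <= t] (nbhs T)] --> V T.
    by move/subspace_continuousP: cV; apply.
  rewrite subr_gt0 => /(_ VTr).
  rewrite near_withinE => /nbhs_ballP[e /= e0 nearT].
  have [s Ss sT] := inf_adherent e0 infS.
  have Ts : T <= s by apply: ge_inf.
  have [s0 Vs] := Ss.
  have : `|V T - V s| < r - V T.
    apply: nearT => //; rewrite /ball/= ltr_distlC.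
    by apply/andP; split; rewrite -/T in sT *; lra.
  by rewrite ltr_distlC => /andP[]; lra.
have T_gt0 : 0 < T.
  by rewrite lt_neqAle T0 andbT; apply: contraTneq VT => <-; rewrite -ltNge.
have : V T <= expR (- k * T) * V 0.
  apply: decr => // s s0 sT; rewrite ltNge; apply/negP => Vs.
  by move: sT; rewrite ltNge ge_inf//; split => //; exact: ltW.
apply/negP; rewrite -ltNge (lt_le_trans _ VT)// (le_lt_trans _ V0r)//.
by rewrite ler_piMl// -expR0 ler_expR mulNr oppr_le0 mulr_ge0.
Qed.

(** * Norms and interior points *)

Lemma pos_lower_bound (R : realType) (I : finType) (f : I -> R) :
  (forall i, 0 < f i) -> exists2 m, 0 < m & forall i, m <= f i.
Proof.
move=> f0; exists (\big[Num.min/1]_i f i); last by move=> i; exact: bigmin_le.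
by apply/bigmin_gtP; split => // i _; exact: f0.
Qed.

Section Norm.
Variables (R : realType) (E : finType) (n : nat).
Implicit Types h : 'I_n -> E -> R.

Lemma dot_ge0 (y : E -> R) : 0 <= dot y y.
Proof. by apply: sumr_ge0 => e _; rewrite -expr2 sqr_ge0. Qed.

Lemma enorm_sqr (y : E -> R) : enorm y ^+ 2 = \sum_e y e ^+ 2.
Proof. by rewrite sqr_sqrtr ?dot_ge0//; apply: eq_bigr => e _; rewrite expr2. Qed.

Lemma pnorm_ge0 h : 0 <= pnorm h. Proof. exact: sqrtr_ge0. Qed.

Lemma pnorm_sqr h : pnorm h ^+ 2 = \sum_(i < n) \sum_e h i e ^+ 2.
Proof.
rewrite sqr_sqrtr; last by apply: sumr_ge0 => i _; exact: dot_ge0.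
by apply: eq_bigr => i _; apply: eq_bigr => e _; rewrite expr2.
Qed.

Lemma pnormZ (t : R) h : pnorm (t *: h) = `|t| * pnorm h.
Proof.
apply: (@pexpIrn _ 2); rewrite ?nnegrE ?mulr_ge0 ?pnorm_ge0//.
rewrite exprMn !pnorm_sqr real_normK ?num_real// mulr_sumr.
apply: eq_bigr => i _; rewrite mulr_sumr; apply: eq_bigr => e _.
by rewrite -exprMn.
Qed.

Lemma coord_le_pnorm h i e : `|h i e| <= pnorm h.
Proof.
rewrite -(@ler_pXn2r _ 2) ?nnegrE ?pnorm_ge0// pnorm_sqr real_normK ?num_real//.
rewrite (bigD1 i)//= (bigD1 e)//= -addrA lerDl addr_ge0// sumr_ge0// => *.
  exact: sqr_ge0.
by apply: sumr_ge0 => *; exact: sqr_ge0.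
Qed.

Lemma load_le_pnorm h e : `|load h e| <= n%:R * pnorm h.
Proof.
apply: le_trans (ler_norm_sum _ _ _) _.
rewrite -[n in n%:R]card_ord -sum1_card natr_sum mulr_suml.
by apply: ler_sum => i _; rewrite mul1r coord_le_pnorm.
Qed.

End Norm.

(** The uniform profile [p] has positive coordinates.  Moving slightly from [x]
    away from [p] stays in the affine hull, hence in the set of profiles; a zero
    coordinate of [x] would then become negative. *)
Lemma relint_profiles_gt0 (R : realType) (E : finType) (n : nat)
    (d : 'I_n -> R) (x : 'I_n -> E -> R) i e :
  (forall j, 0 < d j) -> relint (profiles d) x -> 0 < x i e.
Proof.
move=> d0 [Kx [r [r0 near_x]]].
have E0 : (0 < #|E|)%N by apply/card_gt0P; exists e.
pose p := fun (j : 'I_n) (_ : E) => d j / #|E|%:R.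
have p0 j e' : 0 < p j e' by rewrite divr_gt0// ltr0n.
have Kp : profiles d p.
  move=> j; split=> [e'|]; first exact: ltW.
  rewrite sumr_const -[_ *+ _]mulr_natr divfK// pnatr_eq0 -lt0n//.
pose s := pnorm (x - p) + 1.
have s0 : 0 < s by rewrite ltr_wpDl// pnorm_ge0.
pose t := r / (2 * s).
have t0 : 0 < t by rewrite divr_gt0// mulr_gt0.
have Ky : profiles d ((1 + t) *: x + (- t) *: p).
  apply: near_x.
    exists 2%N, (fun j => if j == ord0 then 1 + t else - t),
      (fun j => if j == ord0 then x else p); split.
    - by rewrite !big_ord_recl big_ord0/=; ring.
    - by move=> j; case: ifP.
    - by rewrite !big_ord_recl big_ord0/= addr0.
  have -> : (1 + t) *: x + (- t) *: p - x = t *: (x - p).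
    apply/funext => j; apply/funext => e'.
    change ((1 + t) * x j e' + (- t) * p j e' - x j e' = t * (x j e' - p j e')).
    by ring.
  rewrite pnormZ gtr0_norm// /t mulrAC ltr_pdivrMr ?mulr_gt0// ltr_pM2l//.
  by rewrite /s; have := pnorm_ge0 (x - p); lra.
have [/(_ e) + _] := Ky i.
change (0 <= (1 + t) * x i e + (- t) * p i e -> 0 < x i e).
have := mulr_gt0 t0 (p0 i e) => tp y0.
rewrite -(pmulr_rgt0 (x i e) (_ : 0 < 1 + t)); lra.
Qed.

(** * The regularized best response *)

Section BestResponse.
Variables (R : realType) (E : finType) (n : nat) (d : 'I_n -> R) (eta : R).
Hypothesis eta_gt0 : 0 < eta.

Let cost (z y : E -> R) := dot z y + eta / 2 * enorm y ^+ 2.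

Lemma cost_expand (z y v : E -> R) :
  cost z (y + v) =
  cost z y + \sum_e (z e + eta * y e) * v e + eta / 2 * \sum_e v e ^+ 2.
Proof.
rewrite /cost !enorm_sqr /dot !mulr_sumr -!big_split/=.
by apply: eq_bigr => e _; have -> : (y + v) e = y e + v e by []; field.
Qed.

(** The cost is strictly convex, so equality of all its partial derivatives, the
    first-order condition with the multiplier of the demand constraint,
    determines the minimizer. *)
Lemma beta_i_kkt i (z y : E -> R) (lam : R) :
  strategies d i y -> (forall e, z e + eta * y e = lam) ->
  beta_i d eta i z = y.
Proof.
move=> Ky kkt.
have costE y' : strategies d i y' ->
    cost z y' = cost z y + eta / 2 * \sum_e (y' - y) e ^+ 2.
  move=> Ky'; rewrite -[in LHS](subrK y y') [y' - y + y]addrC cost_expand.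
  under eq_bigr do rewrite kkt.
  rewrite -mulr_sumr sumrB Ky.2 Ky'.2 subrr mulr0 addr0//.
apply: xget_unique.
  split=> // y' /costE; rewrite /cost => ->; rewrite lerDl mulr_ge0//.
    by rewrite divr_ge0// ltW.
  by apply: sumr_ge0 => e _; exact: sqr_ge0.
move=> y' [Ky' /(_ y Ky)]; rewrite -!/(cost _ _) costE//.
rewrite gerDl pmulr_rle0 ?divr_gt0// => sum_le0; apply/funext => e.
apply/eqP; rewrite -subr_eq0 -[_ - _]/((y' - y) e) -sqrf_eq0 eq_le sqr_ge0 andbT.
apply: le_trans sum_le0; rewrite (bigD1 e)//= lerDl.
by apply: sumr_ge0 => *; exact: sqr_ge0.
Qed.

Let avg (g : E -> R) := (\sum_e g e) / #|E|%:R.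

Lemma sum_centered (g : E -> R) : \sum_e (g e - avg g) = 0.
Proof.
have [E0|E0] := posnP #|E|.
  by rewrite big1// => e; have := fintype0 e E0.
rewrite sumrB sumr_const -[_ *+ _]mulr_natr divfK ?subrr//.
by rewrite pnatr_eq0 -lt0n.
Qed.

(** Conversely, the projection [v] of the gradient on the vectors of zero sum is
    a feasible direction at a positive point; a small step along [- v] would
    strictly decrease the cost if [v] were not zero. *)
Lemma argmin_interior_kkt i (z y : E -> R) :
  (forall e, 0 < y e) ->
  argmin (strategies d i) (fun y' => dot z y' + eta / 2 * enorm y' ^+ 2) y ->
  forall e, z e + eta * y e = avg (fun e => z e + eta * y e).
Proof.
move=> y0 [Ky min_y]; set g := fun e => z e + eta * y e.
pose v e := g e - avg g.
have [m m0 m_le] := pos_lower_bound y0.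
pose S := 1 + \sum_e `|v e|.
have S1 : 1 <= S by rewrite lerDl sumr_ge0.
have v_le e : v e <= S.
  rewrite (le_trans (ler_norm _))// /S (bigD1 e)//= addrCA lerDl.
  by rewrite addr_ge0// sumr_ge0.
(* [t <= m / S] keeps [y - t v] nonnegative; [t <= 1 / eta] makes the
   second-order term at most half of the first-order one. *)
pose t := Num.min (m / S) (1 / eta).
have S0 : 0 < S by lra.
have t0 : 0 < t by rewrite lt_min !divr_gt0.
have Kt : strategies d i (y - t *: v).
  split=> [e|].
    rewrite [_ e]/(y e - t * v e) subr_ge0 (le_trans _ (m_le e))//.
    have : t * v e <= t * S by rewrite ler_pM2l.
    move=> /le_trans; apply; rewrite -ler_pdivlMr// ge_min lexx//.
  by rewrite sumrB Ky.2 -mulr_sumr sum_centered mulr0 subr0.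
have := min_y _ Kt; rewrite -!/(cost _ _) cost_expand -addrA lerDl.
have -> : \sum_e (z e + eta * y e) * (- (t *: v)) e = - t * \sum_e v e ^+ 2.
  have -> : \sum_e v e ^+ 2 = \sum_e g e * v e.
    apply/eqP; rewrite -subr_eq0 -sumrB (eq_bigr (fun e => - avg g * v e)).
      by rewrite -mulr_sumr sum_centered mulr0.
    by move=> e _; rewrite /v; ring.
  rewrite mulr_sumr; apply: eq_bigr => e _.
  by have -> : (- (t *: v)) e = - (t * v e) by []; rewrite /g; ring.
have -> : \sum_e (- (t *: v)) e ^+ 2 = t ^+ 2 * \sum_e v e ^+ 2.
  rewrite mulr_sumr; apply: eq_bigr => e _.
  by have -> : (- (t *: v)) e = - (t * v e) by []; ring.
move=> decrease e.
have te : eta * t <= 1.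
  by rewrite mulrC -ler_pdivlMr// ge_min lexx orbT.
have sum_le0 : \sum_e v e ^+ 2 <= 0.
  rewrite -(pmulr_rle0 (x := t / 2)) ?divr_gt0//.
  have Sv : 0 <= \sum_e v e ^+ 2 by apply: sumr_ge0 => *; exact: sqr_ge0.
  have : (eta * t) * (t * \sum_e v e ^+ 2) <= 1 * (t * \sum_e v e ^+ 2).
    by rewrite ler_wpM2r// mulr_ge0// ltW.
  move: decrease; lra.
apply/eqP; rewrite -subr_eq0 -[_ - _]/(v e) -sqrf_eq0 eq_le sqr_ge0 andbT.
apply: le_trans sum_le0; rewrite (bigD1 e)//= lerDl.
by apply: sumr_ge0 => *; exact: sqr_ge0.
Qed.

(** As long as the affine candidate stays nonnegative it satisfies the
    first-order condition, hence it is the best response. *)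
Lemma beta_i_affine i (z z' : E -> R) : let y := beta_i d eta i z in
  let w := fun e => z' e - z e in
  argmin (strategies d i) (fun y' => dot z y' + eta / 2 * enorm y' ^+ 2) y ->
  (forall e, 0 < y e) ->
  (forall e, w e - avg w <= eta * y e) ->
  beta_i d eta i z' = fun e => y e - (w e - avg w) / eta.
Proof.
move=> y w min_y y0 w_le.
have kkt := argmin_interior_kkt y0 min_y.
apply: (@beta_i_kkt _ _ _ (avg (fun e => z e + eta * y e) + avg w)).
  split=> [e|]; first by rewrite subr_ge0 ler_pdivrMr// mulrC.
  by rewrite sumrB -mulr_suml sum_centered mul0r subr0; case: min_y => -[].
by move=> e; rewrite -(kkt e) /w; field; rewrite gt_eqF.
Qed.

End BestResponse.

(** The default value [0] of [xget] is not a strategy for a nonzero demand. *)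
Lemma beta_i_argmin (R : realType) (E : finType) (n : nat) (d : 'I_n -> R)
    (eta : R) i (z : E -> R) :
  d i != 0 -> strategies d i (beta_i d eta i z) ->
  argmin (strategies d i) (fun y => dot z y + eta / 2 * enorm y ^+ 2)
    (beta_i d eta i z).
Proof.
rewrite /beta_i; case: xgetP => [y _ //|_ di0 [_]].
by rewrite big1// => /esym/eqP; rewrite (negPf di0).
Qed.

(** * Dissipation near the rest point *)

(** On one resource, with equilibrium flows [X] and load [L], the change of
    player [i]'s marginal cost is a multiple of its own deviation plus a
    multiple of the deviation of the load.  The lower bound on
    [a + \sum_i b i], the slope of the total marginal cost in the load, is where the condition
    [2 f' + L f'' >= 0] enters. *)
Lemma resource_marginal_cost (R : realType) (n : nat) (f : R -> R) (eta : R)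
    (X : 'I_n -> R) : classD f -> 0 < eta -> (forall i, 0 <= X i) ->
  let L := \sum_i X i in
  exists r B : R, 0 < r /\ forall x : 'I_n -> R,
    let M := \sum_i x i in
    (forall i, 0 <= x i) -> `|M - L| < r ->
    exists (a : R) (b : 'I_n -> R),
      [/\ 0 <= a <= B, forall i, `|b i| <= B, - (eta / 2) <= a + \sum_i b i &
        forall i, f M + x i * deriv_Rp f M - (f L + X i * deriv_Rp f L) =
          a * (x i - X i) + b i * (M - L)].
Proof.
move=> [[df ddf _] fD] eta0 X0 L.
have L0 : 0 <= L by apply: sumr_ge0.
have XL i : X i <= L by rewrite /L (bigD1 i)//= lerDl sumr_ge0.
have n0 : 0 <= n%:R :> R by [].
pose c1 := deriv_Rp f L; pose c2 := deriv_Rp (deriv_Rp f) L.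
have [] := fD L L0; rewrite -/c1 -/c2 => c1_ge0 c2_ge.
have limit_ge0 : 0 <= (n%:R + 1) * c1 + L * c2.
  have [n_eq0|n_gt0] := posnP n.
    have -> : L = 0.
      by rewrite /L big1// => i; have := ltn_ord i; rewrite [X in (_ < X)%N]n_eq0.
    by rewrite mul0r addr0 mulr_ge0// addr_ge0.
  have n1 : 1 <= n%:R :> R by rewrite ler1n.
  have := mulr_ge0 (_ : 0 <= n%:R - 1) c1_ge0; rewrite subr_ge0 => /(_ n1).
  by move: c2_ge; lra.
(* [eps] bounds the errors on [a], [q] and [p], which enter the sum
   [a + \sum_i b i] with the weights [1], [n] and [L]. *)
pose eps := eta / (2 * (1 + n%:R + L)).
have den0 : 0 < 2 * (1 + n%:R + L) by lra.
have eps0 : 0 < eps by rewrite divr_gt0.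
have epsE : eps * (1 + n%:R + L) = eta / 2 by rewrite /eps; field; lra.
have [r1 r1_gt0 slope1] := slope_Rp (df L L0) eps0.
have [r2 r2_gt0 slope2] := slope_Rp (ddf L L0) eps0.
have D0 : 0 < `|c2| + eps by rewrite ltr_wpDl.
exists (Num.min r1 (Num.min r2 (eps / (`|c2| + eps)))).
exists (c1 + eps + L * (`|c2| + eps)); split.
  by rewrite !lt_min r1_gt0 r2_gt0 divr_gt0.
move=> x M x0; rewrite !lt_min => /and3P[near1 near2 near3].
have M0 : 0 <= M by apply: sumr_ge0.
have [q q_near fE] := slope1 M M0 near1.
have [p p_near dfE] := slope2 M M0 near2.
have p_le : `|p| <= `|c2| + eps.
  by have := ler_normD (p - c2) c2; rewrite subrK; move: p_near; rewrite -/c2; lra.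
have df_near : `|deriv_Rp f M - c1| <= eps.
  rewrite dfE normrM; move: near3; rewrite ltr_pdivlMr// => near3.
  apply: le_trans (ltW near3); rewrite mulrC ler_wpM2l//.
have Lp0 : 0 <= L * (`|c2| + eps) by rewrite mulr_ge0// ltW.
move: q_near p_near df_near; rewrite -/c1 -/c2 ltr_norml ltr_norml ler_norml.
move=> /andP[q1 q2] /andP[p1 p2] /andP[d1 d2].
exists (deriv_Rp f M), (fun i => q + X i * p); split.
- by have [-> _] := fD M M0; lra.
- move=> i; apply: le_trans (ler_normD _ _) _; apply: lerD.
    by rewrite ler_norml; apply/andP; split; lra.
  by rewrite normrM (ger0_norm (X0 i)) ler_pM.
- rewrite big_split/= sumr_const card_ord -mulr_suml -/L -[q *+ n]mulr_natl.
  have : n%:R * (q - c1 + eps) >= 0 by rewrite mulr_ge0//; lra.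
  have : L * (p - c2 + eps) >= 0 by rewrite mulr_ge0//; lra.
  by move: epsE limit_ge0 d1; lra.
- move=> i.
  transitivity (f M - f L + (x i * deriv_Rp f M - X i * c1)); 
    first by rewrite /c1; ring.
  rewrite fE; have -> : X i * c1 = X i * deriv_Rp f M - X i * p * (M - L).
    by rewrite -mulrA -dfE /c1; ring.
  by ring.
Qed.

(** The load equation loses [1 / 2] of [H ^+ 2]; each [h i] loses [h i ^+ 2] up
    to a coupling with [H], split by Young's inequality.  The weight [kappa] is
    chosen so that the sum over [i] of the coupling terms
    [(B / eta) ^+ 2 * H ^+ 2 / 2] is [kappa * H ^+ 2 / 4], half of what the load equation provides. *)
Lemma resource_dissipation (R : realType) (n : nat) (eta a B : R)
    (b h : 'I_n -> R) : let H := \sum_i h i in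
  let kappa := 2 * n%:R * (B / eta) ^+ 2 in
  let D i := - h i - (a * h i + b i * H) / eta in
  0 < eta -> 0 <= a -> (forall i, `|b i| <= B) ->
  - (eta / 2) <= a + \sum_i b i ->
  \sum_i h i * D i + kappa * (H * \sum_i D i) <=
  - (1 / 4) * (\sum_i h i ^+ 2 + kappa * H ^+ 2).
Proof.
move=> H kappa D eta0 a0 bB sum_b.
have kappa0 : 0 <= kappa by rewrite mulr_ge0 ?sqr_ge0// mulr_ge0.
have sumh2 : 0 <= \sum_i h i ^+ 2 by apply: sumr_ge0 => i _; exact: sqr_ge0.
have HD : H * (\sum_i D i) <= - (1 / 2) * H ^+ 2.
  have -> : \sum_i D i = - H * (1 + (a + \sum_i b i) / eta).
    rewrite /D sumrB sumrN -mulr_suml big_split/= -mulr_sumr -mulr_suml -/H.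
    by field; rewrite gt_eqF.
  have : - (1 / 2) <= (a + \sum_i b i) / eta by rewrite ler_pdivlMr//; lra.
  move: (_ / eta) => u u_ge.
  have := mulr_ge0 (sqr_ge0 H) (_ : 0 <= u + 1 / 2); rewrite expr2; lra.
have hD i : h i * D i <= - (1 / 2) * h i ^+ 2 + (1 / 2) * ((B / eta) ^+ 2 * H ^+ 2).
  have b_le : (b i / eta) ^+ 2 <= (B / eta) ^+ 2.
    rewrite !exprMn ler_wpM2r ?sqr_ge0// -[b i ^+ 2]real_normK ?num_real//.
    by rewrite ler_pXn2r ?nnegrE// (le_trans _ (bB i)).
  have -> : h i * D i = - h i ^+ 2 - a / eta * h i ^+ 2 - h i * (b i / eta * H).
    by rewrite /D; ring.
  have := mulr_ge0 (divr_ge0 a0 (ltW eta0)) (sqr_ge0 (h i)).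
  have := sqr_ge0 (h i + b i / eta * H); rewrite sqrrD exprMn.
  have := ler_wpM2r (sqr_ge0 H) b_le; lra.
have : \sum_i h i * D i <= - (1 / 2) * (\sum_i h i ^+ 2) + 1 / 4 * (kappa * H ^+ 2).
  apply: le_trans (ler_sum _ (fun i _ => hD i)) _.
  rewrite big_split/= -mulr_sumr sumr_const card_ord -mulr_natl /kappa.
  by lra.
have := ler_wpM2l kappa0 HD; have := mulr_ge0 kappa0 (sqr_ge0 H); lra.
Qed.

Section Lyapunov.
Variables (R : realType) (E : finType) (n : nat).
Implicit Types (kappa : R) (h : 'I_n -> E -> R).

Definition lyapunov kappa h : R :=
  \sum_e (\sum_i h i e ^+ 2 + kappa * load h e ^+ 2).

(** Half of the derivative of [lyapunov kappa] at [h] in the direction [v]. *)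
Definition lyapunov_dot kappa h (v : 'I_n -> E -> R) : R :=
  \sum_e (\sum_i h i e * v i e + kappa * (load h e * load v e)).

Definition lyapunov_ratio kappa : R := 1 + kappa * (#|E|%:R * n%:R ^+ 2).

Lemma lyapunovE kappa h :
  lyapunov kappa h = pnorm h ^+ 2 + kappa * \sum_e load h e ^+ 2.
Proof. by rewrite /lyapunov big_split/= exchange_big -mulr_sumr pnorm_sqr. Qed.

Lemma pnorm_le_lyapunov kappa h :
  0 <= kappa -> pnorm h ^+ 2 <= lyapunov kappa h.
Proof.
move=> kappa0; rewrite lyapunovE lerDl mulr_ge0// sumr_ge0// => e _.
exact: sqr_ge0.
Qed.

Lemma lyapunov_le_pnorm kappa h :
  0 <= kappa -> lyapunov kappa h <= lyapunov_ratio kappa * pnorm h ^+ 2.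
Proof.
move=> kappa0; rewrite lyapunovE mulrDl mul1r lerD2l -mulrA ler_wpM2l//.
rewrite -mulrA -[#|E|%:R]/(#|xpredT : pred E|%:R) -sum1_card natr_sum mulr_suml.
apply: ler_sum => e _; rewrite mul1r -exprMn -real_normK ?num_real//.
by rewrite ler_pXn2r ?nnegrE ?mulr_ge0 ?pnorm_ge0// load_le_pnorm.
Qed.

Lemma lyapunov_ratio_ge1 kappa : 0 <= kappa -> 1 <= lyapunov_ratio kappa.
Proof. by move=> kappa0; rewrite lerDl !mulr_ge0. Qed.

(** The multipliers [mu] of the demand constraints are invisible to the Lyapunov
    function: the vectors [h i], and therefore the load of [h], have zero sum
    over the resources. *)
Lemma lyapunov_dot_multiplier kappa h (v : 'I_n -> E -> R) (mu : 'I_n -> R) :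
  (forall i, \sum_e h i e = 0) ->
  lyapunov_dot kappa h (fun i e => v i e + mu i) = lyapunov_dot kappa h v.
Proof.
move=> h0; apply/eqP; rewrite -subr_eq0 -sumrB.
rewrite (eq_bigr (fun e => \sum_i h i e * mu i + kappa * (load h e * \sum_i mu i))).
  rewrite big_split/= exchange_big/= big1 => [|i _]; last first.
    by rewrite -mulr_suml h0 mul0r.
  rewrite -mulr_sumr -mulr_suml exchange_big/= big1 => [|i _]; last exact: h0.
  by rewrite mul0r mulr0 addr0.
move=> e _; have -> : load (fun i e => v i e + mu i) e = load v e + \sum_i mu i.
  by rewrite /load big_split.
under eq_bigr do rewrite mulrDr.
by rewrite big_split/=; ring.
Qed.

End Lyapunov.

(** The neighbourhood is chosen so that all the loads lie where
    [resource_marginal_cost] applies, and the projected changes of the marginal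
    costs, of order [pnorm (x - xs)], do not exceed [eta] times a positive lower
    bound of the coordinates of [xs]: the best response is then given by
    [beta_i_affine]. *)
Lemma local_dissipation (R : realType) (E : finType) (n : nat)
    (c : E -> R -> R) (d : 'I_n -> R) (eta : R) (xs : 'I_n -> E -> R) :
  (forall e, classD (c e)) -> (forall i, 0 < d i) -> 0 < eta ->
  (forall i e, 0 < xs i e) -> rest_point c d eta xs ->
  exists kappa r : R, [/\ 0 <= kappa, 0 < r & forall x, profiles d x ->
    pnorm (x - xs) < r ->
    lyapunov_dot kappa (x - xs) (beta d eta (marginal_cost c x) - x) <=
    - (1 / 4) * lyapunov kappa (x - xs)].
Proof.
move=> cD d0 eta0 xs0 [Kxs xs_fix].
have cost_near e := resource_marginal_cost (cD e) eta0 (fun i => ltW (xs0 i e)).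
have [rB0 cost_rB0] := choice cost_near.
have [Bf cost_rB] := choice cost_rB0.
have [rmin rmin0 rmin_le] := pos_lower_bound (fun e => (cost_rB e).1).
have [m m0 m_le] := pos_lower_bound (fun ie : 'I_n * E => xs0 ie.1 ie.2).
pose B := \sum_e `|Bf e|.
have B0 : 0 <= B by apply: sumr_ge0.
have BfB e : Bf e <= B.
  by rewrite (le_trans (ler_norm _))// /B (bigD1 e)//= lerDl sumr_ge0.
have n0 : 0 <= n%:R :> R by [].
pose K := B * (n%:R + 1).
have K0 : 0 <= K by rewrite mulr_ge0// addr_ge0.
exists (2 * n%:R * (B / eta) ^+ 2).
exists (Num.min (rmin / (n%:R + 1)) (eta * m / (2 * K + 1))).
split.
- by rewrite mulr_ge0 ?sqr_ge0// mulr_ge0.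
- by rewrite lt_min !divr_gt0 ?mulr_gt0//; lra.
move=> x Kx; set h := x - xs; set kappa := 2 * _ * _.
rewrite lt_min !ltr_pdivlMr; try lra; move=> /andP[h_rmin h_K].
have h0 i : \sum_e h i e = 0 by rewrite sumrB (Kx i).2 (Kxs i).2 subrr.
pose G i e := marginal_cost c x i e - marginal_cost c xs i e.
have affineG e : exists (a : R) (b : 'I_n -> R),
    [/\ 0 <= a <= B, forall i, `|b i| <= B, - (eta / 2) <= a + \sum_i b i &
      forall i, G i e = a * h i e + b i * load h e].
  have loadh : load h e = load x e - load xs e by rewrite /load sumrB.
  have [|| a [b [/andP[a0 aB] bB ab eqG]]] := (cost_rB e).2 (fun i => x i e).
  - by move=> i; exact: (Kx i).1.
  - rewrite -[X in `|X|]loadh (le_lt_trans (load_le_pnorm _ _))//.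
    by apply: lt_le_trans (rmin_le e); have := pnorm_ge0 h; lra.
  exists a, b; split => //; first by rewrite a0 (le_trans aB).
    by move=> i; apply: le_trans (bB i) _.
  by move=> i; rewrite loadh -eqG.
have G_le i e : `|G i e| <= K * pnorm h.
  have [a [b [/andP[a0 aB] bB _ ->]]] := affineG e.
  have ah : a * `|h i e| <= B * pnorm h by rewrite ler_pM ?coord_le_pnorm.
  have bH : `|b i| * `|load h e| <= B * (n%:R * pnorm h).
    by rewrite ler_pM ?load_le_pnorm.
  apply: le_trans (ler_normD _ _) _; rewrite !normrM (ger0_norm a0) /K; lra.
pose avg i := (\sum_e G i e) / #|E|%:R.
have avg_le i (e : E) : `|avg i| <= K * pnorm h.
  have E0 : 0 < #|E|%:R :> R by rewrite ltr0n; apply/card_gt0P; exists e.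
  rewrite normrM normfV (gtr0_norm E0) ler_pdivrMr//.
  apply: le_trans (ler_norm_sum _ _ _) _.
  by apply: le_trans (ler_sum _ (fun e _ => G_le i e)) _; rewrite sumr_const mulr_natr.
have xs_eq i : xs i = beta_i d eta i (marginal_cost c xs i).
  by rewrite [in LHS]xs_fix.
have betaE i e : (beta d eta (marginal_cost c x) - x) i e =
    - h i e - G i e / eta + avg i / eta.
  change (beta_i d eta i (marginal_cost c x i) e - x i e =
    - (x i e - xs i e) - G i e / eta + avg i / eta).
  rewrite (@beta_i_affine _ _ _ _ _ eta0 i (marginal_cost c xs i)) -?xs_eq.
  - by rewrite -/(G i e) -/(avg i); field; rewrite gt_eqF.
  - rewrite [X in argmin _ _ X]xs_eq; apply: beta_i_argmin; first by rewrite gt_eqF.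
    by rewrite -xs_eq.
  - exact: xs0.
  move=> e'; rewrite -/(G i e') -/(avg i).
  have : eta * m <= eta * xs i e' by rewrite ler_pM2l// (m_le (i, e')).
  have := le_trans (ler_norm _) (G_le i e').
  have := avg_le i e'; rewrite ler_norml => /andP[].
  have := pnorm_ge0 h; lra.
have -> : beta d eta (marginal_cost c x) - x =
    (fun i e => (- h i e - G i e / eta) + avg i / eta).
  by apply/funext => i; apply/funext => e; exact: betaE.
rewrite lyapunov_dot_multiplier// /lyapunov mulr_sumr.
apply: ler_sum => e _; have [a [b [/andP[a0 _] bB ab eqG]]] := affineG e.
rewrite {2}/load; under eq_bigr do rewrite eqG.
under [X in kappa * (_ * X)]eq_bigr do rewrite eqG.
exact: resource_dissipation.
Qed.

(** * The Lyapunov function along solutions *)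

Section Derivation.
Variables (R : realType) (E : finType) (n : nat) (kappa : R).
Variables (x v : R -> 'I_n -> E -> R) (xs : 'I_n -> E -> R).

Lemma is_derive_fsum (I : finType) (f : I -> R -> R) (df : I -> R) (t : R) :
  (forall i, is_derive t 1 (f i) (df i)) ->
  is_derive t 1 (fun s => \sum_i f i s) (\sum_i df i).
Proof.
move=> dfi; rewrite -fct_sumE.
by elim/big_ind2 : _ => // [|? ? ? ? ? ?]; [exact: is_derive_cst|exact: is_deriveD].
Qed.

Lemma is_derive_sqr (f : R -> R) (df t : R) : is_derive t 1 f df ->
  is_derive t 1 (fun s => f s ^+ 2) (2 * (f t * df)).
Proof.
move=> dft; apply: is_derive_eq (is_deriveM dft dft) _.
by rewrite /GRing.scale/=; ring.
Qed.

Lemma is_derive_lyapunov (t : R) :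
  (forall i e, is_derive t 1 (fun s => x s i e) (v t i e)) ->
  is_derive t 1 (fun s => lyapunov kappa (x s - xs))
    (2 * lyapunov_dot kappa (x t - xs) (v t)).
Proof.
move=> dx.
have dh i e : is_derive t 1 (fun s => (x s - xs) i e) (v t i e).
  apply: is_derive_eq (is_deriveB (dx i e) (is_derive_cst (xs i e) t 1)) _.
  by rewrite subr0.
rewrite mulr_sumr; apply: is_derive_fsum => e.
rewrite mulrDr [2 * (kappa * _)]mulrCA mulr_sumr.
apply: is_deriveD; first by apply: is_derive_fsum => i; exact: is_derive_sqr.
apply: (@is_deriveZ _ _ _ (fun s => load (x s - xs) e ^+ 2)).
by apply: is_derive_sqr; exact: is_derive_fsum.
Qed.

Lemma continuous_lyapunov (A : set R) :
  (forall i e, {within A, continuous (fun s => x s i e)}) ->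
  {within A, continuous (fun s => lyapunov kappa (x s - xs))}.
Proof.
move=> cx; apply/subspace_continuousP => t At.
have ch i e : (x s - xs) i e @[s --> within A (nbhs t)] --> (x t - xs) i e.
  apply: cvgB; last exact: cvg_cst.
  by move/subspace_continuousP: (cx i e); apply.
apply: cvg_big => [|e _]; first exact: add_continuous.
apply: cvgD.
  by apply: cvg_big => [|i _]; [exact: add_continuous | exact: cvgM].
have cH : load (x s - xs) e @[s --> within A (nbhs t)] --> load (x t - xs) e.
  by apply: cvg_big => [|i _]; [exact: add_continuous | exact: ch].
by apply: cvgM; [exact: cvg_cst | exact: cvgM].
Qed.

End Derivation.

Unset Implicit Arguments.

Theorem theorem3 (R : realType) (C : set (R -> R))
  (C_sub_D : C `<=` @classD R)
  (C_deriv_gt0 : forall f, C f -> forall x, 0 <= x -> 0 < deriv_Rp f x)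
  (n : nat) (E : finType) (c : E -> R -> R) (c_in_C : forall e, C (c e))
  (d : 'I_n -> R) (d_gt0 : forall i, 0 < d i)
  (eta : R) (eta_gt0 : 0 < eta)
  (xs : 'I_n -> E -> R)
  (xs_interior : relint (profiles d) xs)
  (xs_rest : rest_point c d eta xs) :
  locally_exp_stable c d eta xs.
Proof.
have xs_gt0 i e : 0 < xs i e by exact: relint_profiles_gt0 xs_interior.
have [kappa [r [kappa0 r0 dissip]]] :=
  local_dissipation (fun e => C_sub_D _ (c_in_C e)) d_gt0 eta_gt0 xs_gt0 xs_rest.
have ratio1 := lyapunov_ratio_ge1 E n kappa0.
set rho := lyapunov_ratio E n kappa in ratio1 *.
have rho0 : 0 < rho by lra.
(* A sublevel set of the Lyapunov function is contained in the ball of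
   radius [r] where it dissipates, and contains the ball of radius [r / rho]. *)
pose W := [set y | profiles d y /\ lyapunov kappa (y - xs) < r ^+ 2].
exists W, rho, (1 / 4); split => //; first split.
- by move=> y [].
- exists (r / rho); split=> [|y Ky y_near]; first exact: divr_gt0.
  split=> //; apply: le_lt_trans (lyapunov_le_pnorm _ kappa0) _.
  rewrite -/rho; move: y_near; rewrite ltr_pdivlMr// => y_near.
  apply: (@le_lt_trans _ _ ((pnorm (y - xs) * rho) ^+ 2)).
    by rewrite exprMn mulrC ler_wpM2l ?sqr_ge0// ler_eXnr.
  by rewrite ltr_pXn2r ?nnegrE ?mulr_ge0 ?pnorm_ge0// ltW.
move=> x sol_x [Kx0 Vx0] t t0.
pose V s := lyapunov kappa (x s - xs).
pose v s := beta d eta (marginal_cost c (x s)) - x s.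
have V_le : V t <= expR (- (1 / 2) * t) * V 0.
  apply: (@exp_decay _ V (fun s => 2 * lyapunov_dot kappa (x s - xs) (v s))
    (1 / 2) (r ^+ 2)) => //.
  - apply: continuous_lyapunov => i e; apply: continuous_Rp => s s0.
    by have [_ /(_ i e)[]] := sol_x s s0.
  - move=> s s0; apply: is_derive_lyapunov => i e.
    have [_ /(_ i e)[dx dxE]] := sol_x s (ltW s0).
    by apply: is_derive_eq (is_derive_Rp s0 dx) dxE.
  - move=> s s0 Vs; have [Kx _] := sol_x s (ltW s0).
    have : pnorm (x s - xs) < r.
      rewrite -(@ltr_pXn2r _ 2) ?nnegrE ?pnorm_ge0 ?(ltW r0)//.
      exact: le_lt_trans (pnorm_le_lyapunov _ kappa0) Vs.
    by move=> /(dissip _ Kx); rewrite -/(v s) -/(V s); lra.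
  - by rewrite Vx0 andbT (le_trans _ (pnorm_le_lyapunov _ kappa0))// sqr_ge0.
rewrite -(@ler_pXn2r _ 2) ?nnegrE ?mulr_ge0 ?pnorm_ge0 ?expR_ge0 ?(ltW rho0)//.
apply: le_trans (pnorm_le_lyapunov _ kappa0) _; apply: le_trans V_le _.
have -> : expR (- (1 / 2) * t) = expR (- (1 / 4) * t) ^+ 2.
  by rewrite expr2 -expRD; congr expR; field.
move: (expR _) => decay.
have -> : (rho * decay * pnorm (x 0 - xs)) ^+ 2 =
    decay ^+ 2 * (rho ^+ 2 * pnorm (x 0 - xs) ^+ 2) by ring.
rewrite ler_wpM2l ?sqr_ge0//.
apply: le_trans (lyapunov_le_pnorm _ kappa0) _.
by rewrite ler_wpM2r ?sqr_ge0// ler_eXnr.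
Qed.
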